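(* Let $k\ge 1$ be an integer and let $n$ be an odd positive integer with $\sigma(n)=2^k n$. Write $n={\Pi}M^2$ where ${\Pi}$ is the Euler part of $n$. Suppose all prime factors of $M$ are $\equiv 3\pmod 4$, and ${\Pi}=p_1^{e_1}\cdots p_s^{e_s}q_1^{f_1}\cdots q_{2t}^{f_{2t}}$ with distinct primes $p_i\equiv 1\pmod 4$, distinct primes $q_j\equiv 3\pmod 4$, an integer $t\ge 0$ (so the number of primes $\equiv 3 \pmod 4$ dividing ${\Pi}$ is even), and $\gcd(\sigma({\Pi}),p_1\cdots p_s)=1$. Then $$\Omega\!\left(\frac{\sigma({\Pi})}{2^k}\right)\equiv 0\pmod 2.$$
   Context: $\sigma(m)$ denotes the sum of the positive divisors of $m$. For an odd positive integer $n$, its Euler part ${\Pi}$ is the product of all prime powers $p^e$ with $p^e\parallel n$ (i.e. $p^e\mid n$, $p^{e+1}\nmid n$) and $e$ odd; thus $n={\Pi}M^2$ with $\gcd({\Pi},M)=1$ (so the exponents $e_i,f_j$ above are odd). $\Omega(m)$ denotes the total number of prime factors of $m$ counted with multiplicity. *)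

(* Defs.v *)
From mathcomp Require Import all_boot.

Set Implicit Arguments.
Unset Strict Implicit.
Unset Printing Implicit Defensive.

Definition sigma (m : nat) : nat := \sum_(d <- divisors m) d.

(* For p in [primes n], the e such that p ^ e exactly divides n is [logn p n]. *)
Definition euler_part (n : nat) : nat :=
  \prod_(p <- primes n | odd (logn p n)) p ^ logn p n.

Definition bigOmega (m : nat) : nat := \sum_(p <- primes m) logn p m.

(* Main.v *)
(* Write A = sigma(Pi) / 2^k, so that A * sigma(M^2) = Pi * M^2 with every factor odd.
   Modulo 4 each prime power r^(2a) of M^2 has sigma(r^(2a)) = 1 - 1 + ... + 1 = 1, hence
   sigma(M^2) = 1; also M^2 = 1, and Pi = (-1)^(2t) = 1 because the f_j are odd.
   Thus A = 1 mod 4.  Since A divides n and is coprime to the p_i, all prime factors of A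
   are 3 mod 4, so A = (-1)^Omega(A) mod 4, and Omega(A) is even. *)
Require Import Defs.
From mathcomp Require Import all_boot.

(** Each divisor of [m * n] is [d * e] for a unique pair with [d %| m] and [e %| n]: the gcds with
    [m] and [n] recover [d] and [e]. *)
Lemma sigma_coprimeM m n : coprime m n -> sigma (m * n) = sigma m * sigma n.
Proof.
have [->|m_gt0] := posnP m.
  (* Coprimality with 0 forces the other factor to be 1, and [divisors 0] is [[:: 1]], so both sides
     equal 1. *)
  by rewrite /coprime gcd0n => /eqP->; rewrite /sigma !big_seq1.
have [->|n_gt0] := posnP n.
  by rewrite /coprime gcdn0 => /eqP->; rewrite /sigma !big_seq1.
move=> co_mn; rewrite /sigma.
have gcd_l d e : d %| m -> e %| n -> gcdn (d * e) m = d.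
  move=> dm en; rewrite gcdnC Gauss_gcdl; last exact: coprime_dvdr co_mn.
  exact/gcdn_idPr.
have gcd_r d e : d %| m -> e %| n -> gcdn (d * e) n = e.
  move=> dm en; rewrite gcdnC Gauss_gcdr; last by rewrite coprime_sym (coprime_dvdl dm).
  exact/gcdn_idPr.
have -> : \sum_(d <- divisors (m * n)) d
        = \sum_(x <- [seq d * e | d <- divisors m, e <- divisors n]) x.
  apply/perm_big/uniq_perm; first exact: divisors_uniq.
    apply: allpairs_uniq; try exact: divisors_uniq.
    move=> u v /allpairsP[[d1 e1] /= [d1m e1n ->]].
    case/allpairsP=> [[d2 e2] /= [d2m e2n ->]] /= eq_de.
    rewrite -!dvdn_divisors // in d1m e1n d2m e2n.
    by rewrite -(gcd_l d1 e1) // -{2}(gcd_r d1 e1) // eq_de gcd_l // gcd_r.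
  move=> d; rewrite -dvdn_divisors ?muln_gt0 ?m_gt0 //.
  apply/idP/allpairsP=> [d_mn | [[a b] /= [am bn ->]]]; last first.
    by rewrite -!dvdn_divisors // in am bn; apply: dvdn_mul.
  exists (gcdn d m, gcdn d n); rewrite /= -!dvdn_divisors // !dvdn_gcdr.
  split=> //; apply/eqP; rewrite eqn_dvd; apply/andP; split.
    (* Expanded, the product of the gcds is a gcd of [d * d], [d * n], [m * d] and [m * n], all
       multiples of [d]. *)
    rewrite muln_gcdl !muln_gcdr !dvdn_gcd d_mn dvdn_mulr // dvdn_mulr //.
    by rewrite dvdn_mull.
  rewrite Gauss_dvd ?dvdn_gcdl //.
  by apply: coprime_dvdl (dvdn_gcdr _ _) (coprime_dvdr (dvdn_gcdr _ _) co_mn).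
rewrite big_allpairs_dep big_distrl; apply: eq_bigr => d _ /=.
by rewrite big_distrr.
Qed.

Lemma sigma_pfactor p a : prime p -> sigma (p ^ a) = \sum_(i < a.+1) p ^ i.
Proof.
move=> pr_p; rewrite /sigma.
have -> : \sum_(d <- divisors (p ^ a)) d = \sum_(d <- [seq p ^ i | i <- iota 0 a.+1]) d.
  apply/perm_big/uniq_perm; first exact: divisors_uniq.
    rewrite map_inj_uniq ?iota_uniq //.
    by apply: expnI; apply: prime_gt1.
  move=> d; rewrite -dvdn_divisors ?expn_gt0 ?prime_gt0 //.
  apply/(dvdn_pfactor _ _ pr_p)/mapP=> -[i i_le ->]; exists i => //.
    by rewrite mem_iota.
  by rewrite mem_iota in i_le.
by rewrite big_map -(big_mkord predT (fun i => p ^ i)) /index_iota subn0.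
Qed.

Lemma geom_sum_3mod4 r a : r = 3 %[mod 4] -> \sum_(i < (2 * a).+1) r ^ i = 1 %[mod 4].
Proof.
move=> r3; elim: a => [|a IHa]; first by rewrite big_ord1.
rewrite mulnS !addSn add0n 2!big_ord_recr /= -addnA -modnDml IHa modnDml.
(* The two new terms add up to [(1 + r) * r ^ (2 * a).+1], a multiple of 4. *)
rewrite [r ^ _.+2]expnS -{1}[r ^ _.+1]mul1n -mulnDl -modnDmr.
have dvd_r1 : 4 %| 1 + r by rewrite /dvdn -modnDmr r3.
by rewrite (eqP (dvdn_mulr _ dvd_r1)) addn0.
Qed.

Lemma sigma_sqr_3mod4 M : 0 < M ->
    (forall r, prime r -> r %| M -> r = 3 %[mod 4]) ->
  sigma (M ^ 2) = 1 %[mod 4].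
Proof.
(* Strong induction, splitting off the full power of the least prime factor of [M]. *)
elim/ltn_ind: M => M IHM M_gt0 M3.
have [M_le1|M_gt1] := leqP M 1.
  have -> : M = 1 by apply/eqP; rewrite eqn_leq M_le1.
  by rewrite /sigma big_seq1.
have pr_r := pdiv_prime M_gt1; have r_M := pdiv_dvd M.
have [m co_rm defM] := pfactor_coprime pr_r M_gt0.
set r := pdiv M in pr_r r_M co_rm defM; set a := logn r M in defM.
have a_gt0 : 0 < a by rewrite logn_gt0 mem_primes pr_r M_gt0.
have m_gt0 : 0 < m by move: M_gt0; rewrite defM muln_gt0 => /andP[].
have m_lt : m < M.
  by rewrite defM -{1}[m]muln1 ltn_pmul2l // -(expn0 r) ltn_exp2l ?prime_gt1.
rewrite defM expnMn -expnM sigma_coprimeM; last first.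
  by rewrite coprime_sym coprimeXl // coprimeXr.
rewrite -modnMm (IHM m) // => [|x pr_x x_m]; last first.
  by apply: M3; rewrite // defM dvdn_mulr.
by rewrite sigma_pfactor // mulnC -(mulnC 2) geom_sum_3mod4 // M3.
Qed.

Lemma modn4_bigOmega A : 0 < A ->
    (forall r, prime r -> r %| A -> r = 3 %[mod 4]) ->
  A = 3 ^ bigOmega A %[mod 4].
Proof.
move=> A_gt0 A3; rewrite {1}(prod_prime_decomp A_gt0) prime_decompE big_map /=.
rewrite /bigOmega expn_sum big_seq [in RHS]big_seq.
apply: (big_ind2 (fun x y => x = y %[mod 4])) => // [x1 x2 y1 y2 Hx Hy | r].
  by rewrite -modnMm Hx Hy modnMm.
by rewrite mem_primes => /and3P[pr_r _ r_A]; rewrite -modnXm (A3 r).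
Qed.

(** Since 9 is 1 modulo 4, only the parity of [m] matters. *)
Lemma exp3_mod4_eq1 m : 3 ^ m = 1 %[mod 4] -> m = 0 %[mod 2].
Proof.
rewrite -{1}(odd_double_half m) expnD -mul2n expnM -modnMmr -modnXm exp1n.
by rewrite modnMmr muln1 !modn2; case: (odd m).
Qed.

Lemma logn_partE (pi : nat_pred) r n : r \in pi -> logn r n`_pi = logn r n.
Proof.
move=> pi_r; rewrite -logn_part partn_part ?logn_part // => x.
by rewrite inE /= => /eqP->.
Qed.

(** As a [pi]-part, the Euler part has a complementary [pi^']-part coprime to it, which will turn
    out to be [M ^ 2]. *)
Lemma euler_partE n : euler_part n = n`_[pred p | odd (logn p n)].
Proof.
have [->|n_gt0] := posnP n; first by rewrite /euler_part big_nil partn0.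
rewrite [RHS](prod_prime_decomp (part_gt0 _ _)) prime_decompE big_map /=.
rewrite primes_part big_filter; apply: eq_big => // r odd_r.
by rewrite logn_partE.
Qed.

Lemma logn_prod_prime_powers (I : finType) (q f : I -> nat) j :
    (forall i, prime (q i)) -> injective q ->
  logn (q j) (\prod_i q i ^ f i) = f j.
Proof.
move=> pr_q inj_q; rewrite (bigD1 j) //= mulnC logn_Gauss ?pfactorK //.
apply: (big_rec (coprime (q j))) => [|i m ne_ij co_m]; first exact: coprimen1.
rewrite coprimeMr co_m andbT coprimeXr // prime_coprime // dvdn_prime2 //.
by apply: contraNN ne_ij => /eqP/inj_q->.
Qed.

(* MathComp world.  The division [%/] in the conclusion is exact: under the
   hypotheses sigma (M ^ 2) is odd, so 2 ^ k divides sigma (euler_part n). *)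
Theorem theorem3p4 (k n M s t : nat)
    (p e : 'I_s -> nat) (q f : 'I_(2 * t) -> nat)
    (hk : 1 <= k) (hn : odd n) (hsigma : sigma n = 2 ^ k * n)
    (hM : n = euler_part n * M ^ 2)
    (hMprimes : forall r : nat, prime r -> r %| M -> r = 3 %[mod 4])
    (hPi : euler_part n =
       (\prod_(i < s) p i ^ e i) * (\prod_(j < 2 * t) q j ^ f j))
    (hp_prime : forall i, prime (p i)) (hp_inj : injective p)
    (hp_mod : forall i, p i = 1 %[mod 4]) (he : forall i, 0 < e i)
    (hq_prime : forall j, prime (q j)) (hq_inj : injective q)
    (hq_mod : forall j, q j = 3 %[mod 4]) (hf : forall j, 0 < f j)
    (hgcd : gcdn (sigma (euler_part n)) (\prod_(i < s) p i) = 1) :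
  bigOmega (sigma (euler_part n) %/ 2 ^ k) = 0 %[mod 2].

Proof.
have n_gt0 : 0 < n by apply: odd_gt0.
set pi : nat_pred := [pred r | odd (logn r n)].
have PiE : euler_part n = n`_pi := euler_partE n.
have Pi_gt0 : 0 < euler_part n by rewrite PiE part_gt0.
have M_gt0 : 0 < M.
  by move: n_gt0; rewrite hM muln_gt0 Pi_gt0 expn_gt0 orbF.
have M2E : M ^ 2 = n`_pi^'.
  apply/eqP; rewrite -(eqn_pmul2l Pi_gt0) -hM PiE.
  by rewrite partnC.
(* The [p i] differ from [q j] modulo 4, so [f j] is the exact exponent of [q j] in the Euler part;
   being positive, it is one of the odd exponents of [n]. *)
have f_odd j : odd (f j).
  have f_Pi : logn (q j) (euler_part n) = f j.
    rewrite hPi logn_Gauss ?logn_prod_prime_powers //.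
    apply: (big_rec (coprime (q j))) => [|i m _ co_m]; first exact: coprimen1.
    rewrite coprimeMr co_m andbT coprimeXr // prime_coprime // dvdn_prime2 //.
    by apply/eqP=> eq_qp; have := hq_mod j; rewrite eq_qp hp_mod.
  have : q j \in primes (euler_part n) by rewrite -logn_gt0 f_Pi.
  rewrite PiE primes_part mem_filter => /andP[pi_q _].
  by rewrite -f_Pi PiE logn_partE.
have M2_mod4 : M ^ 2 = 1 %[mod 4].
  have : odd (M %% 4).
    by rewrite odd_mod //; move: hn; rewrite hM oddM oddX => /andP[].
  by rewrite -modnXm; case: (M %% 4) (ltn_pmod M (isT : 0 < 4)) => [|[|[|[|]]]].
have Pi_mod4 : euler_part n = 1 %[mod 4].
  have P1 : \prod_(i < s) p i ^ e i = 1 %[mod 4].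
    apply: (big_ind (fun x => x = 1 %[mod 4])) => // [x y Hx Hy | i _].
      by rewrite -modnMm Hx Hy.
    by rewrite -modnXm hp_mod modnXm exp1n.
  have Q1 : \prod_(j < 2 * t) q j ^ f j = \prod_(j < 2 * t) 3 %[mod 4].
    apply: (big_ind2 (fun x y => x = y %[mod 4])) => // [x1 x2 y1 y2 Hx Hy | j _].
      by rewrite -modnMm Hx Hy modnMm.
    rewrite -modnXm hq_mod modnXm -(odd_double_half (f j)) f_odd -mul2n.
    by rewrite expnD expnM -modnMmr -modnXm exp1n.
  rewrite hPi -modnMm P1 Q1 modnMm mul1n prod_nat_const card_ord expnM.
  by rewrite -modnXm exp1n.
have sM_mod4 : sigma (M ^ 2) = 1 %[mod 4] by apply: sigma_sqr_3mod4.
have sM_odd : odd (sigma (M ^ 2)).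
  by rewrite -(@odd_mod _ 4) ?sM_mod4.
have sn : sigma (euler_part n) * sigma (M ^ 2) = 2 ^ k * n.
  by rewrite -hsigma [in RHS]hM sigma_coprimeM // M2E PiE coprime_partC.
have dvd_k : 2 ^ k %| sigma (euler_part n).
  (* Being odd, [sigma (M ^ 2)] can be cancelled from the divisibility by [2 ^ k]. *)
  have co_k : coprime (2 ^ k) (sigma (M ^ 2)) by rewrite coprimeXl // coprime2n.
  by rewrite -(Gauss_dvdl _ co_k) sn dvdn_mulr.
set A := _ %/ _.
have defA : sigma (euler_part n) = 2 ^ k * A by rewrite mulnC divnK.
have AsM : A * sigma (M ^ 2) = n.
  by apply/eqP; rewrite -(@eqn_pmul2l (2 ^ k)) ?expn_gt0 // mulnA -defA sn.
have A_gt0 : 0 < A by move: n_gt0; rewrite -AsM muln_gt0 => /andP[].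
have A_mod4 : A = 1 %[mod 4].
  (* The factor 1 is traded for [sigma (M ^ 2)], which turns [A] into [n] modulo 4. *)
  rewrite -(muln1 A) -modnMmr -sM_mod4 modnMmr AsM hM.
  by rewrite -modnMm Pi_mod4 M2_mod4.
apply: exp3_mod4_eq1; rewrite -modn4_bigOmega // => r pr_r r_A.
(* A prime [r] dividing [A] divides [M], some [p i] or some [q j]; the case of [p i] contradicts
   [hgcd], as [A] divides [sigma (euler_part n)]. *)
have : r %| n by rewrite -AsM dvdn_mulr.
rewrite hM Euclid_dvdM // Euclid_dvdX // andbT => /orP[|/hMprimes->//].
rewrite hPi Euclid_dvdM // !Euclid_dvd_prod // !big_orE.
case/orP=> /existsP[i]; rewrite /= Euclid_dvdX // => /andP[r_i _].
  have : r %| gcdn (sigma (euler_part n)) (\prod_(i < s) p i).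
    rewrite dvdn_gcd defA dvdn_mull //=.
    by rewrite (bigD1 i) //= dvdn_mulr.
  by rewrite hgcd dvdn1 => /eqP r1; rewrite r1 in pr_r.
by move: r_i; rewrite dvdn_prime2 // => /eqP->.
Qed.
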